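(* Let $\mu$ be a self-similar measure on $\mathbb{R}$ that satisfies the weak separation condition and has support $[0,1]$. Then the quasi-Assouad dimension $\dim_{qA}\mu$ is finite if and only if for every $\varepsilon>0$ there is a constant $C_\varepsilon>0$ such that $$\mu(B(x,r))\geq C_\varepsilon r^{\varepsilon}\mu(B(x,2r))\quad\text{for all }0<r<1\text{ and all }x\in\operatorname{supp}\mu .$$
   Context: $B(x,r)$ denotes the ball of centre $x$ and radius $r$. Self-similar measures. An iterated function system (IFS) is a finite family $\{S_j\}_{j=0}^{m-1}$ of maps $S_j(x)=r_jx+d_j$ on $\mathbb{R}$ with $0<r_j<1$, $d_j\in\mathbb{R}$. Its attractor is the unique non-empty compact set $F$ with $F=\bigcup_j S_j(F)$; here $F=[0,1]$, and the maps are labelled so that $S_0(0)=0$ and $S_{m-1}(1)=1$. Given probabilities $p_j>0$, $\sum_j p_j=1$, the associated self-similar measure $\mu$ is the unique Borel probability measure with $\mu(E)=\sum_j p_j\mu(S_j^{-1}(E))$ for all Borel sets $E$; its support is $F=[0,1]$. Put $\lambda=\min_j r_j$. For a finite word $w=w_1\cdots w_n$ over $\{0,\dots,m-1\}$ put $S_w=S_{w_1}\circ\cdots\circ S_{w_n}$, $r_w=r_{w_1}\cdots r_{w_n}$, $w^-=w_1\cdots w_{n-1}$. For $n\ge 1$, $\Lambda_n$ is the set of finite words $u$ with $r_u\leq\lambda^n$ and $r_{u^-}>\lambda^n$. Weak separation condition (WSC). There is $a>0$ such that for all $n\ge1$, all $u,w\in\Lambda_n$ and each $z\in\{0,1\}$: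 if $S_u(z)\neq S_w(z)$ then $|S_u(z)-S_w(z)|\geq a\lambda^n$. A self-similar measure is said to satisfy the WSC if its underlying weighted IFS $\{S_j,p_j\}$ does. Quasi-Assouad dimension. For a Borel probability measure $\mu$ and $\delta\ge0$ let $H(\delta)$ be the infimum of all $s$ for which there exist $C_1,C_2>0$ such that for all $0<r\leq R^{1+\delta}\leq R\leq C_1$, $$\sup_{x\in\operatorname{supp}\mu}\frac{\mu(B(x,R))}{\mu(B(x,r))}\leq C_2\left(\frac Rr\right)^s .$$ Then $\dim_{qA}\mu=\lim_{\delta\to0}H(\delta)\in[0,\infty]$. *)

(* Defs.v *)
From HB Require Import structures.
From mathcomp Require Import all_boot all_order all_algebra.
From mathcomp Require Import all_classical all_reals all_analysis.
Import Order.TTheory GRing.Theory Num.Theory.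
Import numFieldNormedType.Exports.

Set Implicit Arguments.
Unset Strict Implicit.
Unset Printing Implicit Defensive.

Local Open Scope classical_set_scope.
Local Open Scope ring_scope.

(* The maps are indexed by 'I_m.+1, so a family S_0, ..., S_{m-1} of the usual
   notation has its last map at index ord_max. *)
Record weighted_ifs (R : realType) (m : nat) := WeightedIFS {
  ratio : 'I_m.+1 -> R ;
  offset : 'I_m.+1 -> R ;
  weight : 'I_m.+1 -> R ;
  ratio_gt0 : forall j, 0 < ratio j ;
  ratio_lt1 : forall j, ratio j < 1 ;
  weight_gt0 : forall j, 0 < weight j ;
  weight_sum1 : \sum_j weight j = 1 }.

Section IFS.
Context {R : realType} {m : nat}.
Implicit Types (S : weighted_ifs R m) (u w : seq 'I_m.+1).

Definition ifs_map S (j : 'I_m.+1) (x : R) : R := ratio S j * x + offset S j.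

Definition is_attractor S (F : set R) :=
  [/\ F !=set0, compact F & F = \bigcup_j (ifs_map S j @` F)].

Definition is_self_similar S (mu : probability (measurableTypeR R) R) :=
  forall E : set (measurableTypeR R), measurable E ->
    mu E = (\sum_j (weight S j)%:E * mu (ifs_map S j @^-1` E))%E.

Definition min_ratio S : R := \big[Num.min/ratio S ord0]_j ratio S j.

Definition word_map S w : R -> R := foldr (fun j g => ifs_map S j \o g) idfun w.

Definition word_ratio S w : R := \prod_(j <- w) ratio S j.

Definition word_parent w := take (size w).-1 w.

(* For n >= 1 the empty word, of ratio 1, does not belong to this set, so the
   convention word_parent [::] = [::] plays no role. *)
Definition Lambda S (n : nat) : set (seq 'I_m.+1) :=
  [set u | word_ratio S u <= min_ratio S ^+ n /\
           word_ratio S (word_parent u) > min_ratio S ^+ n].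

Definition weak_separation S :=
  exists2 a : R, 0 < a &
    forall n, (1 <= n)%N -> forall u w, Lambda S n u -> Lambda S n w ->
    forall z : R, z = 0 \/ z = 1 ->
      word_map S u z <> word_map S w z ->
      `|word_map S u z - word_map S w z| >= a * min_ratio S ^+ n.

End IFS.

Section dimension.
Context {R : realType}.
Implicit Type mu : probability (measurableTypeR R) R.

Definition msupport mu : set R :=
  [set x | forall U : set R, open U -> U x -> (0 < mu U)%E].

Definition qA_admissible mu (delta : R) : set R :=
  [set s | exists C1 C2 : R, [/\ 0 < C1, 0 < C2 &
    forall r rho : R, 0 < r -> r <= rho `^ (1 + delta) ->
      rho `^ (1 + delta) <= rho -> rho <= C1 ->
      (ereal_sup [set mu (ball x rho) / mu (ball x r) | x in msupport mu]
        <= (C2 * (rho / r) `^ s)%:E)%E]].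

Definition qA_exponent mu (delta : R) : \bar R :=
  ereal_inf (EFin @` qA_admissible mu delta).

(* qA_exponent is nonincreasing on ]0, +oo[ (is_cvg_qA_exponent below), so this
   limit is never a default value. *)
Definition dim_qA mu : \bar R := lim (qA_exponent mu delta @[delta --> 0^'+]).

Lemma qA_exponent_nonincreasing mu (d1 d2 : R) :
  0 < d1 -> d1 <= d2 -> (qA_exponent mu d2 <= qA_exponent mu d1)%E.
Proof.
move=> d10 d12; apply: ereal_inf_le_tmp => _ [s [C1 [C2 [C10 C20 H]]] <-].
exists s => //; exists C1, C2; split => // r rho r0 r1 r2 r3.
have rho0 : 0 < rho by apply: lt_le_trans r2; apply: lt_le_trans r1.
have rho1 : rho <= 1.
  rewrite leNgt; apply/negP => rho1; move: r2.
  rewrite /powR gt_eqF// -{2}(lnK rho0) ler_expR -ler_pdivlMr ?ln_gt0//.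
  rewrite divff ?gt_eqF ?ln_gt0// gerDl leNgt => /negP; apply.
  exact: lt_le_trans d12.
have rho01 : 0 < rho <= 1 by rewrite rho0.
apply: H => //; first by apply: (le_trans r1); apply: ger_powR; rewrite ?lerD2l.
by apply: ge1r_powR => //; rewrite lerDl ltW.
Qed.

Lemma is_cvg_qA_exponent mu : cvg (qA_exponent mu delta @[delta --> 0^'+]).
Proof.
apply: (@nonincreasing_at_right_is_cvge _ (qA_exponent mu)).
near=> x => a b; rewrite !in_itv/= => /andP[a0 _] /andP[b0 _] ab.
exact: qA_exponent_nonincreasing.
Unshelve. all: by end_near. Qed.

End dimension.

(* Main.v *)
(* If dim_qA mu is finite, some exponent s works for every delta, and comparing
   the radii r and r^(1/(1+delta)) >= 2r with delta = eps/s gives quasi-doubling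
   at small scales; at large scales mu(B(x,r)) >= c r^n by self-similarity.

   Conversely fix R and a level n with lambda^n comparable to R, and let G(d) be
   the total weight of the cells S_u[0,1] of level n at distance <= d from x.
   Then mu(B(x,d)) is at most the weight of the cells at distance < d, whereas
   mu(B(x,2d)) >= c (d/R)^s G(d).  Quasi-doubling removes the factor 2, so G
   drops by at most a factor q, a power of r/R, at each jump in ]r,R[.  By weak
   separation at most one left and one right endpoint lie that close to x, so
   there are at most two jumps, and mu(B(x,r)) >= q^3 mu(B(x,R)). *)

Require Import Defs.
From mathcomp Require Import all_boot all_order all_algebra.
From mathcomp Require Import all_classical all_reals all_analysis.
From mathcomp Require Import measurable_realfun ring lra.
(* [ratio] would otherwise denote the fractions of mathcomp's fraction.v. *)
Import Defs.
Import Order.TTheory GRing.Theory Num.Theory.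
Import numFieldNormedType.Exports.
Local Open Scope classical_set_scope.
Local Open Scope ring_scope.

Set Implicit Arguments.
Unset Strict Implicit.
Unset Printing Implicit Defensive.

(** * Measures as real numbers, and the null complement of the support *)

Section measure_of_balls.
Context {R : realType} (mu : probability (measurableTypeR R) R).
Implicit Types (A B : set R) (x y r : R).

(** Every point off the support lies in an open null set, hence in a null interval with rational
    endpoints. [F] enumerates these intervals, so countable subadditivity applies. *)
Lemma support_setC_null : measurable (~` msupport mu : set (measurableTypeR R)) ->
  mu (~` msupport mu) = 0%E.
Proof.
move=> mS.
pose I (q : rat * rat) : set R := `]ratr q.1, ratr q.2[%classic.
pose F n : set (measurableTypeR R) := if @unpickle (rat * rat)%type n is Some q
  then if mu (I q) == 0%E then I q else set0 else set0.
have F0 n : mu.-negligible (F n).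
  rewrite /F; case: unpickle => [q|]; last exact: negligible_set0.
  case: eqP => [Iq0|_]; last exact: negligible_set0.
  by exists (I q); split => //; exact: measurable_itv.
apply/negligibleP => //; apply: negligibleS (negligible_bigcup F0) => x.
move=> /= /existsNP[U] /not_implyP[oU] /not_implyP[Ux] /negP.
rewrite -leNgt => U0.
have [e /= e0 xeU] : \forall e \near 0^'+, ball x e `<=` U.
  by apply: open_subball.
have [a] := @rat_in_itvoo R (x - e / 2) x ltac:(lra).
have [b] := @rat_in_itvoo R x (x + e / 2) ltac:(lra).
rewrite !in_itv/= => /andP[xb be] /andP[ea ax].
exists (pickle (a, b)); first by []. 
rewrite /F pickleK.
have IU : I (a, b) `<=` U.
  move=> y; rewrite /I/= in_itv/= => /andP[ay yb].
  apply: (xeU (e / 2)) => //=; rewrite ?/ball/= ?sub0r ?normrN.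
  - by rewrite gtr0_norm; lra.
  - by lra.
  - by rewrite ltr_norml; apply/andP; split; lra.
rewrite ifT; first by rewrite /I/= in_itv/= ax.
rewrite eq_le measure_ge0 andbT; apply: le_trans U0.
apply: le_measure => //; rewrite inE; first exact: measurable_itv.
exact: open_measurable.
Qed.

Definition prob A : R := fine (mu A).

Lemma muE A : measurable (A : set (measurableTypeR R)) -> mu A = (prob A)%:E.
Proof. by move=> mA; rewrite fineK// fin_num_measure. Qed.

Lemma prob_ge0 A : 0 <= prob A.
Proof. exact/fine_ge0/measure_ge0. Qed.

Lemma prob_le1 A : measurable (A : set (measurableTypeR R)) -> prob A <= 1.
Proof. by move=> mA; rewrite -lee_fin -muE// probability_le1. Qed.

Lemma le_prob A B : measurable (A : set (measurableTypeR R)) ->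
  measurable (B : set (measurableTypeR R)) -> A `<=` B -> prob A <= prob B.
Proof.
by move=> mA mB AB; rewrite -lee_fin -!muE//; apply: le_measure; rewrite ?inE.
Qed.

End measure_of_balls.

Lemma exists_expr_le {R : realType} (q t : R) :
  0 < q < 1 -> 0 < t -> exists n, q ^+ n <= t.
Proof.
move=> /andP[q0 q1] t0.
have /cvgrPdist_lt/(_ t t0)[n _ nP] : q ^+ n @[n --> \oo] --> 0.
  by apply: cvg_expr; rewrite gtr0_norm.
exists n; have /= := nP n (leqnn n).
by rewrite sub0r normrN => /ltW; apply: le_trans; rewrite ler_norm.
Qed.

(** * Words, their affine maps, and the decomposition of the measure over cut words *)

Section words.
Context {R : realType} {m : nat} (S : weighted_ifs R m).
Implicit Types (j : 'I_m.+1) (u w : seq 'I_m.+1) (x y t : R).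

Lemma min_ratio_gt0 : 0 < min_ratio S.
Proof. by apply: lt_bigmin => *; exact: ratio_gt0. Qed.

Lemma min_ratio_lt1 : min_ratio S < 1.
Proof. by apply: le_lt_trans (ratio_lt1 S ord0); exact: bigmin_le_id. Qed.

Lemma ratio_uniform_bound : exists2 q : R, 0 < q < 1 & forall j, ratio S j <= q.
Proof.
exists (\big[Num.max/ratio S ord0]_j ratio S j) => [|j]; last exact: le_bigmax.
apply/andP; split; last by apply: bigmax_lt => *; exact: ratio_lt1.
by apply: lt_le_trans (ratio_gt0 S ord0) _; exact: bigmax_ge_id.
Qed.

Lemma weight_uniform_bound : exists2 p : R, 0 < p & forall j, p <= weight S j.
Proof.
exists (\big[Num.min/weight S ord0]_j weight S j) => [|j]; last exact: bigmin_le_cond.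
by apply: lt_bigmin => *; exact: weight_gt0.
Qed.

Definition word_weight w : R := \prod_(j <- w) weight S j.

Lemma word_weight_gt0 w : 0 < word_weight w.
Proof. by apply: prodr_gt0 => j _; exact: weight_gt0. Qed.

Lemma word_ratio_gt0 w : 0 < word_ratio S w.
Proof. by apply: prodr_gt0 => j _; exact: ratio_gt0. Qed.

Lemma word_map_affine w x : word_map S w x = word_ratio S w * x + word_map S w 0.
Proof.
rewrite /word_ratio; elim: w => [|j w IH]; first by rewrite big_nil mul1r addr0.
by rewrite big_cons /= IH /ifs_map; ring.
Qed.

Lemma word_map_rcons w j : word_map S (rcons w j) = word_map S w \o ifs_map S j.
Proof. by elim: w => //= i w ->. Qed.

Lemma measurable_affine (a b : R) (A : set (measurableTypeR R)) :
  measurable A -> measurable ((fun x => a * x + b) @^-1` A : set (measurableTypeR R)).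
Proof.
move=> mA; rewrite -[X in measurable X]setTI.
have : measurable_fun [set: measurableTypeR R] (fun x : R => a * x + b).
  by apply: continuous_measurable_fun => x; apply: cvgD;
    [apply: cvgMr; exact: cvg_id | exact: cvg_cst].
by apply => //; exact: measurableT.
Qed.

Lemma measurable_word_preimage w (A : set (measurableTypeR R)) :
  measurable A -> measurable (word_map S w @^-1` A : set (measurableTypeR R)).
Proof.
move=> mA.
rewrite (_ : word_map S w = fun x => word_ratio S w * x + word_map S w 0).
  exact: measurable_affine.
by apply/funext => x; exact: word_map_affine.
Qed.

Lemma self_similar_prob (mu : probability (measurableTypeR R) R)
    (A : set (measurableTypeR R)) :
  is_self_similar S mu -> measurable A ->
  prob mu A = \sum_j weight S j * prob mu (ifs_map S j @^-1` A).
Proof.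
move=> ss mA; apply: EFin_inj; rewrite -muE// ss// -sumEFin.
apply: eq_bigr => j _; rewrite EFinM -muE//; exact: measurable_affine.
Qed.

(* For [t = min_ratio S ^+ n] and [N] large this list lies in [Lambda S n], for
   which it is substituted: only its decomposition of [mu] matters. *)
Fixpoint cut_words t N : seq (seq 'I_m.+1) :=
  if N is N'.+1 then
    flatten [seq if word_ratio S u <= t then [:: u]
                 else [seq rcons u j | j <- enum 'I_m.+1] | u <- cut_words t N']
  else [:: [::]].

Lemma prob_cut_words (mu : probability (measurableTypeR R) R) t N
    (A : set (measurableTypeR R)) :
  is_self_similar S mu -> measurable A ->
  prob mu A = \sum_(u <- cut_words t N) word_weight u * prob mu (word_map S u @^-1` A).
Proof.
move=> ss mA; elim: N => [|N ->]; first by rewrite big_seq1 /word_weight big_nil mul1r.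
rewrite big_flatten big_map /=; apply: eq_bigr => u _.
case: ifP => _; first by rewrite big_seq1.
rewrite big_map big_enum/=.
rewrite (self_similar_prob ss (measurable_word_preimage u mA)) mulr_sumr.
apply: eq_bigr => j _.
by rewrite word_map_rcons /word_weight big_rcons mulrA.
Qed.

(** Only words of ratio above the threshold are extended, so the parent of an extended word is above
    it. A word extended in all [N] rounds has ratio at most [q ^+ N], which is below the threshold
    for [N] large. *)
Lemma cut_words_Lambda n : (0 < n)%N ->
  exists N, {in cut_words (min_ratio S ^+ n) N, forall u, Lambda S n u}.
Proof.
move=> n0; set t := min_ratio S ^+ n.
have t0 : 0 < t by rewrite exprn_gt0// min_ratio_gt0.
have t1 : t < 1 by rewrite exprn_ilt1 ?ltW ?min_ratio_gt0 ?min_ratio_lt1// -lt0n.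
have [q /andP[q0 q1] rq] := ratio_uniform_bound.
have cutP N : {in cut_words t N, forall u, (u = [::] \/ t < word_ratio S (word_parent u)) /\
    (word_ratio S u <= t \/ (word_ratio S u <= q ^+ N))}.
  elim: N => [|N IH] u.
    by rewrite inE => /eqP ->; split; [left|right; rewrite expr0 /word_ratio big_nil].
  move=> /flatten_mapP[v /IH[vl vr]]; case: ifPn => [vt|].
    by rewrite inE => /eqP ->; split => //; left.
  rewrite -ltNge => tv /mapP[j _ ->]; split.
    by right; rewrite /word_parent size_rcons -cats1 take_size_cat.
  have -> : word_ratio S (rcons v j) = word_ratio S v * ratio S j.
    by rewrite /word_ratio -cats1 big_cat big_seq1.
  right; case: vr => [|vr]; first by rewrite leNgt tv.
  by rewrite exprSr ler_pM// ltW// ?ratio_gt0// word_ratio_gt0.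
have [N qN] : exists N, q ^+ N <= t by apply: exists_expr_le; rewrite ?q0.
exists N => u /cutP[uP ut].
have {}ut : word_ratio S u <= t by case: ut => // ut; exact: le_trans qN.
(* The empty word is excluded because its ratio 1 exceeds [t]; this is where [0 < n] enters. *)
split => //; case: uP => // u0; move: ut.
by rewrite u0 /word_ratio big_nil leNgt t1.
Qed.

End words.

(** * Polynomial lower bound for the measure of balls *)

Section self_similar.
Context {R : realType} {m : nat} (S : weighted_ifs R m)
  (mu : probability (measurableTypeR R) R).
Context (attr : is_attractor S `[0, 1]%classic) (ss : is_self_similar S mu)
  (supp : msupport mu = `[0, 1]%classic).

Lemma prob_disjoint_unit (A : set (measurableTypeR R)) : measurable A ->
  (forall x : R, 0 <= x <= 1 -> ~ A x) -> prob mu A = 0.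
Proof.
move=> mA A01.
have mS : measurable (~` msupport mu : set (measurableTypeR R)).
  by rewrite supp; apply: measurableC; exact: measurable_itv.
suff : prob mu A <= prob mu (~` msupport mu).
  by rewrite {2}/prob support_setC_null//= => ?; apply/eqP; rewrite eq_le prob_ge0 andbT.
apply: le_prob => // x Ax; rewrite supp /= in_itv/= => x01; exact: A01 x01 Ax.
Qed.

(** Zooming in: a point of [0, 1] is the image of some [z] under a map of the family, and
    self-similarity reduces its ball to one about [z] with radius enlarged by [1 / q], at the cost
    of a factor at least [p]. The number of steps is logarithmic in [t]. *)
Lemma prob_ball_ge_pow : exists2 c : R, 0 < c <= 1 & exists s,
  forall y t : R, 0 <= y <= 1 -> 0 < t <= 1 -> c * t ^+ s <= prob mu (ball y t).
Proof.
have [q /andP[q0 q1] rq] := ratio_uniform_bound S.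
have [p p0 pw] := weight_uniform_bound S.
set c0 := prob mu (ball (2^-1 : R) (2^-1)).
have c00 : 0 < c0.
  have h : msupport mu (2^-1 : R) by rewrite supp/= in_itv/=; lra.
  have oB : open (ball (2^-1 : R) 2^-1) by exact: ball_open.
  have Bx : ball (2^-1 : R) 2^-1 2^-1 by apply: ballxx; rewrite invr_gt0.
  have := h _ oB Bx.
  rewrite (muE mu (measurable_ball _ _)) lte_fin; exact.
have scale k (y t : R) : 0 <= y <= 1 -> q ^+ k <= t -> c0 * p ^+ k <= prob mu (ball y t).
  elim: k y t => [|k IH] y t y01 qt.
    rewrite expr0 in qt *; rewrite mulr1; apply: le_prob; try exact: measurable_ball.
    move=> x; rewrite /ball/= => h; apply: lt_le_trans qt; move: h.
    by rewrite !ltr_norml; lra.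
  have : `[0, 1]%classic y by rewrite /= in_itv.
  case: attr => _ _ -> [j _ [z]]; rewrite /= in_itv/= => z01 yE.
  have mB := measurable_ball y t.
  rewrite (self_similar_prob ss mB) (bigD1 j)//= exprS mulrCA.
  apply: ler_wpDr.
    by apply: sumr_ge0 => i _; rewrite mulr_ge0 ?prob_ge0// ltW// weight_gt0.
  apply: ler_pM => //; first exact: ltW.
    by rewrite mulr_ge0 ?exprn_ge0 ?ltW.
  apply: le_trans (IH z (t / q) z01 _) _.
    by rewrite ler_pdivlMr// -exprSr.
  apply: le_prob; [exact: measurable_ball|exact: measurable_affine|].
  move=> x; rewrite /ball/= => xz; rewrite /ifs_map -yE /ifs_map.
  rewrite opprD addrACA subrr addr0 -mulrBr normrM gtr0_norm ?ratio_gt0//.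
  apply: le_lt_trans (_ : q * `|z - x| < _); first by rewrite ler_wpM2r.
  by rewrite mulrC -ltr_pdivlMr.
(* This [s] turns the loss [p ^+ k] into a power of the radius: [p ^+ k] is at least
   [(q ^+ k) ^+ s]. *)
have [s qs] : exists s, q ^+ s <= p by apply: exists_expr_le; rewrite ?q0.
have c01 : c0 <= 1 by apply: prob_le1; exact: measurable_ball.
exists (c0 * q ^+ s).
  apply/andP; split; first by rewrite mulr_gt0// exprn_gt0.
  by rewrite mulr_ile1 ?exprn_ile1 ?exprn_ge0//; exact: ltW.
exists s => y t y01 /andP[t0 t1].
have ex : exists k, q ^+ k <= t by apply: exists_expr_le; rewrite ?q0.
case: (ex_minnP ex) => k kt kmin; apply: le_trans (scale k y t y01 kt).
rewrite -mulrA ler_pM2l// -exprMn.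
(* By minimality of [k], [q ^+ k] undershoots [t] by at most one factor [q]; hence the [q ^+ s] in
   the constant. *)
have qtk : q * t <= q ^+ k.
  case: k kt kmin => [|k] kt kmin; first by rewrite mulr_ile1//; exact: ltW.
  rewrite exprS ler_pM2l// ltW// ltNge; apply/negP => /kmin.
  by rewrite ltnn.
apply: le_trans (_ : (q ^+ k) ^+ s <= _).
  by rewrite lerXn2r// nnegrE ?mulr_ge0 ?exprn_ge0 ?ltW.
by rewrite exprAC lerXn2r// nnegrE ?exprn_ge0 ?ltW.
Qed.

End self_similar.

(** * Admissible exponents, and quasi-doubling from finite dimension *)

Section dimension.
Context {R : realType} (mu : probability (measurableTypeR R) R).
Implicit Types (x r rho s delta eps : R).

Lemma prob_ball_gt0 x r : msupport mu x -> 0 < r -> 0 < prob mu (ball x r).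
Proof.
move=> xs r0.
have := xs _ (ball_open x r) (ballxx x r0).
by rewrite (muE mu (measurable_ball _ _)) lte_fin; exact.
Qed.

Lemma le_prob_ball x r rho : r <= rho -> prob mu (ball x r) <= prob mu (ball x rho).
Proof.
move=> rr; apply: le_prob; [exact: measurable_ball..|exact: le_ball].
Qed.

(** Balls centred in the support have positive measure, so the extended quotients are real and the
    supremum can be replaced by a bound at each centre. *)
Lemma qA_admissibleE delta s : qA_admissible mu delta s <->
  exists C1 C2 : R, [/\ 0 < C1, 0 < C2 &
    forall r rho : R, 0 < r -> r <= rho `^ (1 + delta) ->
      rho `^ (1 + delta) <= rho -> rho <= C1 -> forall x, msupport mu x ->
      prob mu (ball x rho) <= C2 * (rho / r) `^ s * prob mu (ball x r)].
Proof.
have quotE x r rho : msupport mu x -> 0 < r ->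
    (mu (ball x rho) / mu (ball x r))%E = (prob mu (ball x rho) / prob mu (ball x r))%:E.
  move=> xs r0; rewrite !(muE mu (measurable_ball _ _)).
  by rewrite inver gt_eqF ?prob_ball_gt0.
split=> -[C1 [C2 [C10 C20 H]]]; exists C1, C2; split => // r rho r0 h1 h2 h3.
  move=> x xs; rewrite -ler_pdivrMr ?prob_ball_gt0// -lee_fin -quotE//.
  by apply: le_trans (H _ _ r0 h1 h2 h3); apply: ereal_sup_ubound; exists x.
apply: ge_ereal_sup => _ [x xs <-].
by rewrite quotE// lee_fin ler_pdivrMr ?prob_ball_gt0//; exact: H.
Qed.

Lemma qA_exponent_le_dim delta : 0 < delta -> (qA_exponent mu delta <= dim_qA mu)%E.
Proof.
move=> d0; apply: lime_ge; first exact: is_cvg_qA_exponent.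
near=> d; apply: qA_exponent_nonincreasing; first by near: d; exact: nbhs_right_gt.
by near: d; exact: nbhs_right_le.
Unshelve. all: by end_near. Qed.

Lemma powR1D rho delta : 0 < rho -> rho `^ (1 + delta) = rho * rho `^ delta.
Proof.
by move=> h; rewrite powRD ?(gt_eqF h) ?implybT// powRr1// ltW.
Qed.

(** With [s < 0], shrinking [r] at fixed [rho] drives (rho / r)^s to 0, and the larger ball would
    have less mass than the smaller. This rules out the value -oo for the dimension. *)
Lemma qA_exponent_ge0 delta : msupport mu !=set0 -> 0 < delta ->
  (0 <= qA_exponent mu delta)%E.
Proof.
move=> [x xs] d0; apply: le_ereal_inf_tmp => _ [s /qA_admissibleE[C1 [C2 [C10 C20 H]]] <-].
rewrite lee_fin leNgt; apply/negP => s0.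
set rho := Num.min C1 1.
have rho0 : 0 < rho by rewrite lt_min C10 ltr01.
have rho1 : rho <= 1 by rewrite ge_min lexx orbT.
(* The smaller radius is [rho / T]. The first term puts it below rho^(1 + delta); the second, as
   [s < 0], gives T^s <= 1 / (2 C2). *)
set T := Num.max (rho `^ (- delta)) ((2 * C2) `^ (- s^-1)).
have T0 : 0 < T by rewrite lt_max powR_gt0.
have r0 : 0 < rho / T by rewrite divr_gt0.
have hr : rho / T <= rho `^ (1 + delta).
  rewrite ler_pdivrMr// powR1D// -mulrA ler_peMr ?(ltW rho0)//.
  apply: (@le_trans _ _ (rho `^ delta * rho `^ (- delta))).
    by rewrite -powRD ?subrr ?powRr0// (gt_eqF rho0) implybT.
  by rewrite ler_pM2l ?powR_gt0// le_max lexx.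
have hrr : rho `^ (1 + delta) <= rho by apply: ge1r_powR; rewrite ?rho0// lerDl ltW.
have := H _ _ r0 hr hrr; rewrite ge_min lexx => /(_ isT x xs).
rewrite invf_div mulrCA divff ?gt_eqF// mulr1.
apply/negP; rewrite -ltNge.
have Pr := prob_ball_gt0 xs r0.
apply: (@lt_le_trans _ _ (prob mu (ball x (rho / T)))).
  rewrite -[ltRHS]mul1r ltr_pM2r//.
  have : T `^ s <= (2 * C2)^-1.
    rewrite -[leRHS]powR_inv1; last by rewrite mulr_ge0// ltW.
    rewrite (_ : -1 = - s^-1 * s); last by rewrite mulNr mulVf ?lt_eqF.
    rewrite powRrM; set E := (2 * C2) `^ _.
    have E0 : 0 < E by rewrite powR_gt0// mulr_gt0.
    rewrite -[s]opprK ![_ `^ (- - s)]powRN lef_pV2 ?posrE ?powR_gt0 ?mulr_gt0//.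
    apply: ge0_ler_powR; rewrite ?nnegrE ?oppr_ge0 ?(ltW s0) ?(ltW E0) ?(ltW T0)//.
    by rewrite /T le_max lexx orbT.
  rewrite -(ler_pM2l C20) => /le_lt_trans; apply.
  by rewrite invfM mulrCA divff ?gt_eqF// mulr1; lra.
by apply: le_prob_ball; exact: le_trans hrr.
Qed.
Lemma quasi_doubling_of_dim_qA :
  (exists2 c : R, 0 < c & exists n, forall x r,
     msupport mu x -> 0 < r <= 1 -> c * r ^+ n <= prob mu (ball x r)) ->
  (dim_qA mu < +oo)%E ->
  forall eps, 0 < eps -> exists2 C : R, 0 < C &
    forall r, 0 < r < 1 -> forall x, msupport mu x ->
      C * r `^ eps * prob mu (ball x (2 * r)) <= prob mu (ball x r).
Proof.
move=> [c c0 [n lower]] dimy eps eps0.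
have [s s0 sP] : exists2 s : R, 0 < s & forall delta, 0 < delta ->
    exists2 s', s' <= s & qA_admissible mu delta s'.
  have [l dl] : exists l : R, (dim_qA mu < l%:E)%E.
    case: (dim_qA mu) dimy => [l| |]// _; last by exists 0; exact: ltNyr.
    by exists (l + 1); rewrite lte_fin ltrDl.
  exists (Num.max l 1) => [|delta d0]; first by rewrite lt_max ltr01 orbT.
  have /ereal_inf_lt[_ [s' s'P <-]] := le_lt_trans (qA_exponent_le_dim d0) dl.
  by rewrite lte_fin => /ltW s'l; exists s' => //; rewrite le_max s'l.
(* With rho = r^(1 / (1 + delta)), this choice gives (rho / r)^s = rho^(- eps) <= r^(- eps). *)
pose delta := eps / s.
have d0 : 0 < delta by rewrite divr_gt0.
have d1 : 0 < 1 + delta by rewrite addr_gt0.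
have [s' s's /qA_admissibleE[C1 [C2 [C10 C20 H]]]] := sP _ d0.
(* For [r <= r0] the first term yields [rho <= C1], the second rho^delta <= 1/2, that is, 2r <=
   rho. *)
pose r0 := Num.min (C1 `^ (1 + delta)) (2^-1 `^ ((1 + delta) / delta)).
have r00 : 0 < r0 by rewrite lt_min !powR_gt0// invr_gt0.
have r01 : r0 <= 1.
  rewrite ge_min; apply/orP; right; rewrite -[leRHS](powRr0 2^-1).
  by apply: ger_powR; [lra|rewrite divr_ge0// ltW].
have C2c : 0 < Num.min C2^-1 (c * r0 ^+ n).
  by rewrite lt_min invr_gt0 C20 mulr_gt0// exprn_gt0.
exists (Num.min C2^-1 (c * r0 ^+ n)) => // r /andP[rp r1] x xs.
have re1 : r `^ eps <= 1.
  rewrite -[leRHS](powRr0 r); apply: ger_powR; last exact: ltW.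
  by rewrite rp ltW.
(* Above [r0], the polynomial lower bound at radius [r0] suffices. *)
have [rr0|/ltW r0r] := leP r r0; last first.
  have /(lower _ _ xs)/le_trans : 0 < r0 <= 1 by rewrite r00.
  move=> /(_ _ (le_prob_ball x r0r)); apply: le_trans.
  apply: (@le_trans _ _ (Num.min C2^-1 (c * r0 ^+ n))).
    rewrite -mulrA ler_piMr ?(ltW C2c)// mulr_ile1 ?powR_ge0 ?prob_ge0//.
    by apply: prob_le1; exact: measurable_ball.
  by rewrite ge_min lexx orbT.
pose rho := r `^ (1 + delta)^-1.
have rho0 : 0 < rho by rewrite powR_gt0.
have rhoE : rho `^ (1 + delta) = r.
  by rewrite -powRrM mulVf ?gt_eqF// powRr1// ltW.
have rrho : r = rho * rho `^ delta by rewrite -rhoE powR1D.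
have rho1 : rho <= 1.
  rewrite -[leRHS](powRr0 r); apply: ger_powR; first by rewrite rp ltW.
  by rewrite invr_ge0 ltW.
have mono (a b p : R) : 0 < p -> 0 <= a -> 0 <= b -> a `^ p <= b `^ p -> a <= b.
  move=> p0 a0 b0 ab; rewrite leNgt; apply/negP => ba; move: ab.
  by rewrite leNgt gt0_ltr_powR// nnegrE.
have rhoC1 : rho <= C1.
  apply: (mono _ _ (1 + delta)); rewrite ?(ltW rho0) ?(ltW C10)// rhoE.
  by apply: le_trans rr0 _; rewrite ge_min lexx.
have rhod : rho `^ delta <= 2^-1.
  apply: (mono _ _ ((1 + delta) / delta)); rewrite ?powR_ge0 ?divr_gt0 ?invr_ge0//.
  rewrite -powRrM mulrCA divff ?gt_eqF// mulr1 rhoE.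
  by apply: le_trans rr0 _; rewrite ge_min lexx orbT.
have rho_le : rho `^ (1 + delta) <= rho.
  by rewrite powR1D// ler_piMr ?(ltW rho0)//; lra.
have hr : r <= rho `^ (1 + delta) by rewrite rhoE.
have {H} := H r rho rp hr rho_le rhoC1 x xs.
have quot : rho / r = (rho `^ delta)^-1.
  by rewrite rrho invfM mulrA divff ?gt_eqF// mul1r.
have : (rho / r) `^ s' <= r `^ (- eps).
  apply: (@le_trans _ _ ((rho / r) `^ s)).
    by apply: ler_powR => //; rewrite quot invf_ge1 ?powR_gt0//; lra.
  rewrite quot -powRN -powRrM.
  rewrite (_ : - delta * s = - eps); last by rewrite mulNr /delta divfK ?gt_eqF.
  rewrite !powRN lef_pV2 ?posrE ?powR_gt0//; apply: ge0_ler_powR.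
  - exact: ltW.
  - by rewrite nnegrE ltW.
  - by rewrite nnegrE ltW.
  - by rewrite -rhoE.
move=> h1 h2.
have {h2} h2 : prob mu (ball x (2 * r)) <= C2 * r `^ (- eps) * prob mu (ball x r).
  apply: (@le_trans _ _ (prob mu (ball x rho))).
    apply: le_prob_ball; rewrite -ler_pdivlMl// rrho mulrC ler_pM2r//.
  apply: le_trans h2 _; rewrite ler_wpM2r ?prob_ge0// ler_pM2l//.
apply: (@le_trans _ _ (C2^-1 * r `^ eps * prob mu (ball x (2 * r)))).
  by rewrite !ler_wpM2r ?prob_ge0 ?powR_ge0// ge_min lexx.
rewrite -mulrA ler_pdivrMl// -ler_pdivlMl ?powR_gt0//.
by rewrite -powRN mulrA [_ * C2]mulrC.
Qed.

End dimension.

(** * Loss of mass across finitely many distances, and the choice of a level *)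

Section weighted_points.
Context {R : realType} {I : eqType} (L : seq I) (p D : I -> R)
  (p_ge0 : forall u, 0 <= p u).

Lemma ler_sum_subpred (P Q : pred I) : {in L, forall u, P u -> Q u} ->
  \sum_(u <- L | P u) p u <= \sum_(u <- L | Q u) p u.
Proof.
move=> PQ; rewrite !(big_mkcond P) !(big_mkcond Q) big_seq [leRHS]big_seq.
apply: ler_sum => u /PQ; case: ifP => [_ ->//|_ _].
by case: ifP.
Qed.

(* Between two consecutive values of [D] the mass is constant, so one factor [q]
   is lost at each value of [D] inside ]r, rho[. *)
Lemma mass_chain (q r rho : R) (s : seq R) : 0 <= q <= 1 ->
  (forall d, r < d < rho ->
     q * (\sum_(u <- L | (D u <= d)%R) p u) <= \sum_(u <- L | (D u < d)%R) p u) ->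
  sorted >=%R s -> {in L, forall u, r < D u < rho -> D u \in s} ->
  q ^+ size s * (\sum_(u <- L | (D u < rho)%R) p u)
    <= \sum_(u <- L | (D u <= r)%R) p u.
Proof.
move=> /andP[q0 q1]; elim: s rho => [|d s IH] rho qP sorted_s DL.
  rewrite expr0 mul1r; apply: ler_sum_subpred => u uL Du.
  by rewrite leNgt; apply/negP => rD; have := DL u uL; rewrite rD Du => /(_ isT).
have sorted_s' := path_sorted sorted_s.
(* The list decreases, so no value of [D] lies in ]d, rho[ and the mass below [rho] is at most the
   mass up to [d]. One factor [q] then pays for passing strictly below [d]. *)
have [/andP[rd drho]|dN] := boolP (r < d < rho).
  rewrite exprSr -mulrA.
  apply: le_trans (IH d _ sorted_s' _) => [|e /andP[re ed]|u uL /andP[rD Dd]].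
  - rewrite ler_wpM2l ?exprn_ge0//; apply: le_trans (qP d _); last by rewrite rd.
    rewrite ler_wpM2l//; apply: ler_sum_subpred => u uL Du.
    have [Dr|rD] := leP (D u) r; first exact: le_trans (ltW rd).
    have := DL u uL; rewrite rD Du inE => /(_ isT)/orP[/eqP->//|Ds].
    exact: (allP (order_path_min ge_trans sorted_s)).
  - by apply: qP; rewrite re (lt_trans ed).
  - have := DL u uL; rewrite rD (lt_trans Dd)// inE => /(_ isT)/orP[/eqP dE|//].
    by rewrite dE ltxx in Dd.
(* A [d] outside ]r, rho[ needs no crossing; its factor [q <= 1] is given away. *)
rewrite exprS -mulrA; apply: (@le_trans _ _ (q ^+ size s * \sum_(u <- L | (D u < rho)%R) p u)).
  by rewrite ler_piMl// mulr_ge0 ?exprn_ge0// sumr_ge0.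
apply: IH => // u uL Du; have := DL u uL Du; rewrite inE => /orP[/eqP dE|//].
by rewrite -dE Du in dN.
Qed.

End weighted_points.

(** [n] is one less than the first [k] with [a * l ^+ k < rho]; the bound [rho <= a * l] forces
    [k >= 2], hence [n >= 1], as weak separation demands. *)
Lemma exists_scale {R : realType} (a l rho : R) :
  0 < a -> 0 < l < 1 -> 0 < rho -> rho <= a * l ->
  exists2 n, (0 < n)%N & rho <= a * l ^+ n /\ a * l * l ^+ n < rho.
Proof.
move=> a0 l01 rho0 rhol.
have ex : exists k, a * l ^+ k < rho.
  have [|k kP] := @exists_expr_le _ l (rho / (2 * a)) l01.
    by rewrite divr_gt0// mulr_gt0.
  exists k; apply: (@le_lt_trans _ _ (a * (rho / (2 * a)))); first by rewrite ler_pM2l.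
  rewrite (_ : a * _ = rho / 2); first by lra.
  by field; rewrite gt_eqF.
case: (ex_minnP ex) => -[|[|k]] kP kmin.
- move: kP; rewrite expr0 mulr1 ltNge (le_trans rhol)// ler_piMr ?(ltW a0)//.
  by case/andP: l01 => _ /ltW.
- by move: kP; rewrite expr1 ltNge rhol.
exists k.+1 => //; split; last by rewrite -mulrA -exprS.
by rewrite leNgt; apply/negP => /kmin; rewrite ltnn.
Qed.

(** * Cells of one level near a point *)

Section weak_separation.
Context {R : realType} {m : nat} (S : weighted_ifs R m)
  (mu : probability (measurableTypeR R) R).
Context (attr : is_attractor S `[0, 1]%classic) (ss : is_self_similar S mu)
  (supp : msupport mu = `[0, 1]%classic).
Implicit Types (x rho : R) (u w : seq 'I_m.+1).

(** Distance from [x] to the cell S_u[0, 1], whose left end is the image of 0 because the maps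
    increase. *)
Definition cell_dist x u : R :=
  Num.max 0 (Num.max (word_map S u 0 - x) (x - word_map S u 1)).

(** A cell at distance at least [rho] misses the open ball; any other contributes at most its
    weight. *)
Lemma prob_ball_le_mass t N x rho :
  prob mu (ball x rho) <=
    \sum_(u <- cut_words S t N | (cell_dist x u < rho)%R) word_weight S u.
Proof.
rewrite (prob_cut_words t N ss (measurable_ball x rho)) [leRHS]big_mkcond.
apply: ler_sum => u _.
have mB := measurable_word_preimage S u (measurable_ball x rho).
case: ltP => [_|xu].
  by rewrite ler_piMr ?prob_le1//; exact/ltW/word_weight_gt0.
rewrite prob_disjoint_unit ?mulr0// => z /andP[z0 z1].
rewrite /preimage/= /ball/= word_map_affine ltr_norml => /andP[h1 h2].
have r0 := word_ratio_gt0 S u.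
have rz0 : 0 <= word_ratio S u * z by rewrite mulr_ge0// ltW.
have rz1 : word_ratio S u * z <= word_ratio S u by rewrite ler_piMr// ltW.
move: xu; rewrite leNgt => /negP; apply.
rewrite /cell_dist !gt_max (word_map_affine S u 1) mulr1.
by apply/and3P; split; lra.
Qed.

(** A cell within [rho] of [x] has a point [word_map S u z] that close. Its map has ratio at most
    [t], so it sends the ball of radius [rho / t] about [z] into the ball of radius [2 * rho] about
    [x]. *)
Lemma mass_le_prob_ball (c t : R) (s N : nat) x rho :
  (forall y r : R, 0 <= y <= 1 -> 0 < r <= 1 -> c * r ^+ s <= prob mu (ball y r)) ->
  0 <= c -> {in cut_words S t N, forall u, word_ratio S u <= t} ->
  0 < rho <= t ->
  c * (rho / t) ^+ s *
    (\sum_(u <- cut_words S t N | (cell_dist x u <= rho)%R) word_weight S u)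
    <= prob mu (ball x (2 * rho)).
Proof.
move=> lower c0 ut /andP[rho0 rhot].
have t0 : 0 < t by exact: lt_le_trans rhot.
rewrite (prob_cut_words t N ss (measurable_ball x _)) mulr_sumr.
rewrite big_mkcond big_seq [leRHS]big_seq; apply: ler_sum => u uL.
case: ifPn => [xu|_]; last by rewrite mulr_ge0 ?prob_ge0// ltW// word_weight_gt0.
rewrite mulrC ler_pM2l ?word_weight_gt0//.
have r0 := word_ratio_gt0 S u.
have [z z01 zx] : exists2 z, 0 <= z <= 1 & `|x - word_map S u z| <= rho.
  move: xu; rewrite /cell_dist !ge_max => /and3P[_].
  rewrite (word_map_affine S u 1) mulr1 => x0 x1.
  have [h0|h0] := ltP x (word_map S u 0).
    by exists 0; rewrite ?lexx ?ler01// ler_norml; lra.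
  have [h1|h1] := ltP (word_ratio S u + word_map S u 0) x.
    exists 1; rewrite ?lexx ?ler01// ler_norml (word_map_affine S u 1) mulr1; lra.
  exists ((x - word_map S u 0) / word_ratio S u).
    by rewrite divr_ge0 ?(ltW r0) ?subr_ge0//= ler_pdivrMr// mul1r; lra.
  by rewrite word_map_affine mulrC divfK ?gt_eqF// subrK subrr normr0 ltW.
apply: le_trans (lower z (rho / t) z01 _) _.
  by rewrite divr_gt0//= ler_pdivrMr// mul1r.
apply: le_prob; [exact: measurable_ball|by apply: measurable_word_preimage; exact: measurable_ball|].
move=> y; rewrite /preimage /ball/= => zy.
have -> : x - word_map S u y = (x - word_map S u z) + word_ratio S u * (z - y).
  by rewrite (word_map_affine S u y) (word_map_affine S u z); ring.
apply: le_lt_trans (ler_normD _ _) _.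
suff : `|word_ratio S u * (z - y)| < rho by lra.
rewrite normrM gtr0_norm//; apply: le_lt_trans (_ : t * `|z - y| < _).
  by rewrite ler_wpM2r// ut.
by rewrite mulrC -ltr_pdivlMr.
Qed.

(** A positive distance is attained at a left endpoint to the right of [x] or a right endpoint to
    its left. Two distinct endpoints of the same kind in this range would be closer than [rho],
    against separation. *)
Lemma cell_dist_values (a t : R) n N x rho :
  (forall u w, Lambda S n u -> Lambda S n w -> forall z : R, z = 0 \/ z = 1 ->
     word_map S u z <> word_map S w z ->
     `|word_map S u z - word_map S w z| >= a * min_ratio S ^+ n) ->
  {in cut_words S t N, forall u, Lambda S n u} ->
  rho <= a * min_ratio S ^+ n ->
  exists d1 d2 : R, {in cut_words S t N, forall u,
    0 < cell_dist x u < rho -> cell_dist x u \in [:: d1; d2]}.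
Proof.
move=> sep LL rhoa.
(* The isometry [f] is the signed distance to [x], so one argument serves both kinds of endpoint. *)
have uniq_val (z : R) (f : R -> R) : z = 0 \/ z = 1 ->
    (forall y y' : R, `|f y - f y'| = `|y - y'|) ->
    exists d, {in cut_words S t N, forall u, 0 < f (word_map S u z) < rho ->
      f (word_map S u z) = d}.
  move=> z01 fiso.
  have [[w [wL w0]]|none] := pselect (exists w, w \in cut_words S t N /\
      0 < f (word_map S w z) < rho).
    exists (f (word_map S w z)) => u uL u0; congr f.
    apply/eqP/negPn/negP => /eqP /(sep u w (LL _ uL) (LL _ wL) z z01).
    apply/negP; rewrite -ltNge; apply: lt_le_trans rhoa.
    by rewrite -fiso ltr_norml; lra.
  by exists 0 => u uL u0; exfalso; apply: none; exists u.
have [d1 d1P] := @uniq_val 0 (fun y => y - x) (or_introl erefl) ltac:(by move=> y y'; congr `|_|; ring).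
have [d2 d2P] := @uniq_val 1 (fun y => x - y) (or_intror erefl)
  ltac:(by move=> y y'; rewrite distrC; congr `|_|; ring).
exists d1, d2 => u uL; rewrite /cell_dist !inE.
case: (leP 0) => [_|]; last by rewrite ltxx.
case: (leP (word_map S u 0 - x)) => _ h; first by rewrite (d2P u uL h) eqxx orbT.
by rewrite (d1P u uL h) eqxx.
Qed.

End weak_separation.

(* The exponent [N] does not depend on [delta]: quasi-doubling with
   [eps = delta / (1 + delta)] loses a factor [r `^ (- eps) <= rho / r]. *)
Lemma qA_admissible_of_quasi_doubling (R : realType) (m : nat)
    (S : weighted_ifs R m) (mu : probability (measurableTypeR R) R) :
  is_attractor S `[0, 1]%classic -> is_self_similar S mu ->
  msupport mu = `[0, 1]%classic -> weak_separation S ->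
  (forall eps : R, 0 < eps -> exists2 C : R, 0 < C &
     forall r : R, 0 < r < 1 -> forall x : R, msupport mu x ->
       C * r `^ eps * prob mu (ball x (2 * r)) <= prob mu (ball x r)) ->
  exists N : nat, forall delta : R, 0 < delta -> qA_admissible mu delta N%:R.
Proof.
move=> attr ss supp [a a0 sep] qd.
have [c /andP[c0 c1] [s lower]] := prob_ball_ge_pow attr ss supp.
(* Each loss is [q0 * b ^+ s.+1] with [b = r / rho]: [s] powers from the lower bound on balls, one
   from quasi-doubling. There are three losses: two jumps, and the final passage to the ball of
   radius [r]. *)
exists ((s.+1) * 3)%N => delta d0; apply/qA_admissibleE.
have e0 : 0 < delta / (1 + delta) by rewrite divr_gt0// addr_gt0.
have [C C0 CP] := qd _ e0.
set l := min_ratio S in sep.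
have l0 : 0 < l := min_ratio_gt0 S.
have l1 : l < 1 := min_ratio_lt1 S.
(* The cap at 1 keeps [rho] below the level scale [t], not only below the separation distance. *)
set a' := Num.min a 1.
have a'0 : 0 < a' by rewrite lt_min a0 ltr01.
have a'1 : a' <= 1 by rewrite ge_min lexx orbT.
set K := a' * l; set C' := Num.min C 1.
have K0 : 0 < K by rewrite mulr_gt0.
have K1 : K < 1 by apply: le_lt_trans l1; rewrite ler_piMl// ltW.
have C'0 : 0 < C' by rewrite lt_min C0 ltr01.
have C'1 : C' <= 1 by rewrite ge_min lexx orbT.
set q0 := C' * c * K ^+ s.
have q00 : 0 < q0 by rewrite !mulr_gt0// exprn_gt0.
have q01 : q0 <= 1.
  by rewrite !mulr_ile1 ?mulr_ge0 ?exprn_ge0 ?exprn_ile1//; exact: ltW.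
exists K, (q0 ^- 3); split; rewrite ?invr_gt0 ?exprn_gt0// => r rho r0 rrho1 rho1 rhoK x xs.
(* [powR] is nonnegative at every base and vanishes at 0 for a positive exponent, so [0 < r] forces
   this. *)
have rho0 : 0 < rho.
  rewrite lt_neqAle eq_sym; apply/andP; split.
    apply/eqP => rhoE; move: rrho1; rewrite rhoE powR0 ?gt_eqF ?addr_gt0//.
    by rewrite leNgt r0.
  by apply: le_trans rho1; exact: powR_ge0.
have rrho : r <= rho := le_trans rrho1 rho1.
set b := r / rho.
have b0 : 0 < b by rewrite divr_gt0.
have b1 : b <= 1 by rewrite ler_pdivrMr// mul1r.
have reps : b <= r `^ (delta / (1 + delta)).
  have d1 : 0 < 1 + delta by rewrite addr_gt0.
  rewrite (_ : delta / (1 + delta) = 1 - (1 + delta)^-1); last first.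
    by field; rewrite gt_eqF.
  rewrite powRB ?(gt_eqF r0) ?implybT// powRr1 ?(ltW r0)//.
  rewrite ler_pM2l// lef_pV2 ?posrE ?powR_gt0//.
  have -> : rho = (rho `^ (1 + delta)) `^ (1 + delta)^-1.
    by rewrite -powRrM mulfV ?gt_eqF// powRr1// ltW.
  by apply: ge0_ler_powR; rewrite ?nnegrE ?powR_ge0 ?invr_ge0 ?(ltW d1) ?(ltW r0).
have l01 : 0 < l < 1 by rewrite l0.
have [n n0 [rhol lrho]] := exists_scale a'0 l01 rho0 rhoK.
set t := l ^+ n in rhol lrho.
have t0 : 0 < t by rewrite exprn_gt0.
have [N LL] := cut_words_Lambda S n0.
rewrite -/l -/t in LL.
have rhot : rho <= t by apply: le_trans rhol _; rewrite ler_piMl// ltW.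
have rhoa : rho <= a * min_ratio S ^+ n.
  by apply: le_trans rhol _; rewrite ler_wpM2r// ?ge_min ?lexx// ltW.
have [d1 [d2 dP]] := cell_dist_values x (sep n n0) LL rhoa.
set L := cut_words S t N.
set q := q0 * b ^+ s.+1.
have q_gt0 : 0 < q by rewrite mulr_gt0// exprn_gt0.
have q_le1 : q <= 1 by rewrite mulr_ile1 ?exprn_ge0 ?exprn_ile1 ?(ltW q00) ?(ltW b0).
have main d : r <= d -> d <= rho ->
    q * (\sum_(u <- L | (cell_dist S x u <= d)%R) word_weight S u) <= prob mu (ball x d).
  move=> rd drho.
  have dpos : 0 < d by exact: lt_le_trans rd.
  have d01 : 0 < d < 1 by rewrite dpos (le_lt_trans drho)// (le_lt_trans rhoK).
  apply: le_trans (CP d d01 x xs).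
  have dt : 0 < d <= t by rewrite dpos (le_trans drho).
  have Lt : {in L, forall u, word_ratio S u <= t} by move=> u /LL[].
  apply: (@le_trans _ _ (C * d `^ (delta / (1 + delta)) * (c * (d / t) ^+ s *
      (\sum_(u <- L | (cell_dist S x u <= d)%R) word_weight S u)))); last first.
    rewrite ler_pM2l; first exact: (mass_le_prob_ball ss x lower (ltW c0) Lt dt).
    by rewrite mulr_gt0// powR_gt0.
  rewrite mulrA ler_wpM2r ?sumr_ge0//; first by move=> u _; exact/ltW/word_weight_gt0.
  (* [C' * b] pays for quasi-doubling, as [b] is at most the same power of [d]; and [K * b <= d / t]
     since [K * t < rho] and [r <= d]. *)
  rewrite (_ : q = (C' * b) * (c * (K * b) ^+ s)); last first.
    by rewrite /q /q0 [(K * b) ^+ s]exprMn [b ^+ s.+1]exprS; ring.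
  have C'b : 0 <= C' * b by exact/ltW/mulr_gt0.
  have Kb : 0 <= K * b by exact/ltW/mulr_gt0.
  have cKb : 0 <= c * (K * b) ^+ s by rewrite mulr_ge0 ?exprn_ge0// ltW.
  apply: ler_pM => //.
    apply: ler_pM; [exact: ltW|exact: ltW|by rewrite ge_min lexx|].
    apply: le_trans reps _; apply: ge0_ler_powR => //; rewrite ?nnegrE; exact: ltW.
  rewrite ler_pM2l// lerXn2r ?nnegrE// ?divr_ge0 ?(ltW dpos) ?(ltW t0)//.
  rewrite ler_pdivlMr//; apply: le_trans rd.
  rewrite (_ : K * b * t = r * (K * t / rho)); last by rewrite /b; ring.
  by rewrite ler_piMr ?(ltW r0)// ler_pdivrMr// mul1r ltW.
set ds := sort >=%R [:: d1; d2].
have sds : sorted >=%R ds by apply: sort_sorted; exact: ge_total.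
have chain := @mass_chain _ _ L (word_weight S) (cell_dist S x)
  (fun u => ltW (word_weight_gt0 S u)) q r rho ds.
have {}chain : q ^+ 2 * (\sum_(u <- L | (cell_dist S x u < rho)%R) word_weight S u)
    <= \sum_(u <- L | (cell_dist S x u <= r)%R) word_weight S u.
  rewrite (_ : 2%N = size ds); last by rewrite size_sort.
  apply: chain => //; first by rewrite q_le1 ltW.
    (* The open ball of radius [d] sees only cells at distance strictly below [d], so [main]
       compares closed and open mass. *)
    move=> d /andP[rd drho]; apply: le_trans (main d (ltW rd) (ltW drho)) _.
    exact: prob_ball_le_mass.
  move=> u uL /andP[ru urho]; rewrite mem_sort; apply: dP => //.
  by rewrite urho (lt_trans r0 ru).
have : q ^+ 3 * prob mu (ball x rho) <= prob mu (ball x r).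
  apply: le_trans (main r (lexx _) rrho).
  rewrite exprS -mulrA ler_pM2l//; apply: le_trans chain.
  by rewrite ler_pM2l ?exprn_gt0//; exact: prob_ball_le_mass.
rewrite -ler_pdivlMl ?exprn_gt0// => /le_trans; apply.
rewrite powR_mulrn ?divr_ge0 ?(ltW r0) ?(ltW rho0)//.
rewrite (_ : rho / r = b^-1); last by rewrite /b invf_div.
by rewrite /q exprMn -exprM invfM exprVn.
Qed.

Theorem theoremA (R : realType) (m : nat) (S : weighted_ifs R m)
    (mu : probability (measurableTypeR R) R) :
  is_attractor S `[0, 1]%classic ->
  ifs_map S ord0 0 = 0 ->
  ifs_map S ord_max 1 = 1 ->
  is_self_similar S mu ->
  msupport mu = `[0, 1]%classic ->
  weak_separation S ->
  (dim_qA mu \is a fin_num) <->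
  (forall eps : R, 0 < eps ->
     exists2 C : R, 0 < C &
       forall r : R, 0 < r < 1 -> forall x : R, msupport mu x ->
         (mu (ball x r) >= (C * r `^ eps)%:E * mu (ball x (2 * r)))%E).
Proof.
move=> attr _ _ ss supp wsc.
have muball x r : mu (ball x r) = (prob mu (ball x r))%:E.
  exact: (muE mu (measurable_ball _ _)).
split=> [dim_fin|qd].
  have lower : exists2 c : R, 0 < c & exists n, forall x r : R,
      msupport mu x -> 0 < r <= 1 -> c * r ^+ n <= prob mu (ball x r).
    have [c /andP[c0 _] [n H]] := prob_ball_ge_pow attr ss supp.
    by exists c => //; exists n => x r; rewrite supp /= in_itv; exact: H.
  move=> eps eps0.
  have := quasi_doubling_of_dim_qA lower _ eps0.
  move: dim_fin; rewrite fin_numElt => /andP[_ dimy] /(_ dimy)[C C0 CP].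
  exists C => // r r01 x xs; rewrite !muball -EFinM lee_fin; exact: CP.
have [|N NP] := @qA_admissible_of_quasi_doubling _ _ S mu attr ss supp wsc.
  move=> eps eps0; have [C C0 CP] := qd eps eps0; exists C => // r r01 x xs.
  by have := CP r r01 x xs; rewrite !muball -EFinM lee_fin.
have supp0 : msupport mu !=set0 by exists 0; rewrite supp/= in_itv/= lexx ler01.
(* From below, the dimension dominates the nonnegative exponent at [delta = 1]; from above, [N]
   bounds every exponent. *)
rewrite fin_numElt; apply/andP; split.
  apply: (@lt_le_trans _ _ 0%E); first exact: ltNyr.
  exact: le_trans (qA_exponent_ge0 supp0 ltr01) (qA_exponent_le_dim mu ltr01).
apply: (@le_lt_trans _ _ (N%:R)%:E); last exact: ltry.
apply: lime_le; first exact: is_cvg_qA_exponent.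
near=> delta; apply: ereal_inf_lbound; exists N%:R => //; apply: NP.
by near: delta; exact: nbhs_right_gt.
Unshelve. all: by end_near. Qed.
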